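(* Let $k$ be a constant positive integer and $\epsilon>0$. There is a randomized distributed algorithm in the LOCAL model with round complexity $O(\mathrm{poly}(\log n/\epsilon))$ that computes, with high probability, a $(1+\epsilon)$-approximation of the minimum $k$-spanner of the $n$-vertex input graph.
   Context: For a connected undirected graph $G=(V,E)$, a subgraph $H\subseteq E$ is a $k$-spanner if for every edge $\{u,v\}\in E$ there is a path of length at most $k$ between $u$ and $v$ in $H$. The minimum $k$-spanner problem asks for a $k$-spanner with the minimum number of edges; a $(1+\epsilon)$-approximation is a $k$-spanner of size at most $(1+\epsilon)$ times the minimum. Distributed setting: the input graph is the communication network; vertices have unique IDs and initially know only their neighbors; computation proceeds in synchronous rounds; each vertex outputs a subset of its incident edges, and the union of outputs is the spanner. In the LOCAL model messages have unbounded size and local computation is unbounded. ''With high probability'' means with probability at least $1-1/n^c$ for a constant $c\geq 1$; vertices know a polynomial upper bound on $n$. *)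

(* Defs.v *)
From mathcomp Require Import all_boot all_order all_algebra.
From mathcomp Require Import boolp reals exp.

Set Implicit Arguments.
Unset Strict Implicit.
Unset Printing Implicit Defensive.

Import Order.TTheory GRing.Theory Num.Theory.
Local Open Scope ring_scope.

Record sgraph := SGraph {
  vertex :> finType;
  adj : rel vertex;
  adj_sym : symmetric adj;
  adj_irr : irreflexive adj
}.

Definition connected_graph (G : sgraph) : Prop :=
  (0 < #|G|)%N /\ forall u v : G, connect (@adj G) u v.

Definition edges (G : sgraph) : {set {set G}} :=
  [set [set u; v] | u in [set: G], v in [set: G] & adj u v].

Definition kspanner (k : nat) (G : sgraph) (H : {set {set G}}) : Prop :=
  H \subset edges G /\
  forall u v : G, adj u v ->
    exists p : seq G,
      [/\ path (fun x y => [set x; y] \in H) u p, last u p = v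
        & (size p <= k)%N].

Definition min_kspanner (k : nat) (G : sgraph) (H : {set {set G}}) : Prop :=
  kspanner k H /\
  forall H' : {set {set G}}, kspanner k H' -> (#|H| <= #|H'|)%N.

Definition approx_min_kspanner (R : realType) (eps : R) (k : nat)
    (G : sgraph) (H : {set {set G}}) : Prop :=
  kspanner k H /\
  exists2 Hmin : {set {set G}}, min_kspanner k Hmin
    & #|H|%:R <= (1 + eps) * #|Hmin|%:R.

(* A randomized algorithm in the LOCAL model. Vertices know each other only
   through their identifiers, which are natural numbers; N is the upper bound
   on the number of vertices that every vertex knows. States and messages live
   in arbitrary types and all the functions are arbitrary, as neither message
   size nor local computation is bounded.
   - rbits N: length of the private random string of each vertex;
   - init N i nb w: initial state of the vertex with identifier i, neighbours'
     identifiers nb (in increasing order) and private random string w;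
   - send s i: message sent in state s to the neighbour with identifier i;
   - recv s inbox: state after receiving the messages of the inbox, each one
     tagged with the identifier of its sender;
   - output s: None as long as the vertex runs; Some f once it has halted, f
     selecting, by the neighbours' identifiers, a subset of the incident
     edges. *)
Record local_alg := LocalAlg {
  state : Type;
  msg : Type;
  rbits : nat -> nat;
  init : forall N : nat, nat -> seq nat -> (rbits N).-tuple bool -> state;
  send : state -> nat -> msg;
  recv : state -> seq (nat * msg) -> state;
  output : state -> option (pred nat)
}.

Definition halted (A : local_alg) (s : state A) : bool := isSome (output s).

Section Execution.
Variables (A : local_alg) (G : sgraph) (id : G -> nat) (N : nat).

Definition nbrs (v : G) : seq G :=
  sort (fun x y => (id x <= id y)%N) (enum [pred u | adj v u]).

Definition rand_tapes := {ffun G -> (rbits A N).-tuple bool}.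

Definition init_config (w : rand_tapes) (v : G) : state A :=
  init (id v) [seq id u | u <- nbrs v] (w v).

(* One synchronous round; a halted vertex keeps its state and sends nothing. *)
Definition round (s : G -> state A) (v : G) : state A :=
  if halted (s v) then s v else
  recv (s v)
    [seq (id u, send (s u) (id v)) | u <- nbrs v & ~~ halted (s u)].

Definition config (w : rand_tapes) (t : nat) : G -> state A :=
  iter t round (init_config w).

Definition all_halted (w : rand_tapes) (t : nat) : Prop :=
  forall v : G, halted (config w t v).

Definition selects (s : state A) (i : nat) : bool :=
  if output s is Some f then f i else false.

Definition output_edges (w : rand_tapes) (t : nat) : {set {set G}} :=
  [set [set u; v] | u in [set: G], v in [set: G]
     & adj u v && selects (config w t u) (id v)].

End Execution.

(* Uniform probability on a finite type. On rand_tapes this makes the private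
   random strings independent and uniformly distributed. *)
Definition Pr (R : realType) (T : finType) (P : T -> Prop) : R :=
  #|[pred w : T | `[< P w >]]|%:R / #|T|%:R.

(* Main.v *)
Require Import Defs.
From mathcomp Require Import all_boot all_order all_algebra.
From mathcomp Require Import boolp reals exp.
From mathcomp Require Import zify ring lra.

(* The network is decomposed into clusters by the random-radius construction of
   Linial and Saks, repeated in O(log n) independent phases.  In a phase every
   vertex draws a truncated geometric radius, counted in units of a separation
   distance D, and v follows the vertex of largest identifier whose ball
   contains v; v is clustered if it does not lie in the last layer of that ball.
   Two clusters of one phase are then at distance more than D, and raising one
   bit of its leader shows that v is clustered with probability almost 1/2, so
   that w.h.p. every vertex is clustered in some phase.

   The phases are processed in order.  Each cluster grows a ball around itself
   until an optimal set X of edges spanning all the unspanned edges of the next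
   larger ball costs at most 1 + eps times the optimum for the current ball, and
   adds X to the output.  The optimum cannot grow by the factor 1 + eps more
   than O(log n / eps) times.  Edges spanned by different clusters through the
   smaller balls are more than 2k apart, so these local optima are charged to
   disjoint parts of a minimum spanner. *)

Set Implicit Arguments.
Unset Strict Implicit.
Unset Printing Implicit Defensive.

Import Order.TTheory GRing.Theory Num.Theory.
Local Open Scope ring_scope.
Local Open Scope nat_scope.

(** * Environments, balls and agreement of two environments on a ball *)

Definition vrecord : Type := seq nat * seq bool.

(** Describes both the true network and the partial view gathered by a vertex, so that the same
    predicates can be evaluated on either. *)
Definition env := nat -> vrecord.

Fixpoint ball (e : env) (r x y : nat) : bool :=
  (x == y) ||
  (if r is r'.+1 then has (fun z => ball e r' z y) (e x).1 else false).

Definition agree (e e' : env) (r x : nat) : Prop :=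
  forall y, ball e r x y -> e y = e' y.

Lemma ball_refl e r x : ball e r x x.
Proof. by case: r => [|r] /=; rewrite eqxx. Qed.

Lemma ball_nbr e x y : y \in (e x).1 -> ball e 1 x y.
Proof.
by move=> xy /=; apply/orP; right; apply/hasP; exists y; rewrite ?eqxx.
Qed.

Lemma ball_leq e r r' x y : r <= r' -> ball e r x y -> ball e r' x y.
Proof.
elim: r r' x => [|r IH] [|r'] x //= lerr'; first by rewrite orbF => ->.
case/orP=> [->//|/hasP[z xz zy]]; apply/orP; right; apply/hasP; exists z => //.
exact: IH zy.
Qed.

Lemma ball_trans e r1 r2 x y z :
  ball e r1 x y -> ball e r2 y z -> ball e (r1 + r2) x z.
Proof.
elim: r1 x => [|r1 IH] x /=; first by rewrite orbF => /eqP ->.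
case/orP=> [/eqP -> yz|/hasP[u xu uy] yz].
  exact: (@ball_leq e r2 (r1 + r2).+1) (leqW (leq_addl _ _)) yz.
by apply/orP; right; apply/hasP; exists u => //; apply: IH.
Qed.

Lemma ball_sym e r x y :
  (forall x y, y \in (e x).1 -> x \in (e y).1) -> ball e r x y -> ball e r y x.
Proof.
move=> esym; elim: r x => [|r IH] x /=; first by rewrite !orbF eq_sym.
case/orP=> [|/hasP[z xz /IH zy]]; first by rewrite eq_sym => ->.
by rewrite -[_ || _]/(ball e r.+1 y x) -addn1; apply: ball_trans zy (ball_nbr _);
  apply: esym.
Qed.

Lemma agree_ball e e' r x y :
  agree e e' r x -> ball e' r x y = ball e r x y.
Proof.
elim: r x => [//|r IH] x ag /=; congr (_ || _).
rewrite -(ag x (ball_refl _ _ _)); apply: eq_in_has => z xz; apply: IH => t zt.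
by apply: ag => /=; apply/orP; right; apply/hasP; exists z.
Qed.

Lemma agree_leq e e' r r' x : r <= r' -> agree e e' r' x -> agree e e' r x.
Proof. by move=> le ag y xy; apply: ag; apply: ball_leq xy. Qed.

Lemma agreeC e e' r x : agree e e' r x -> agree e' e r x.
Proof. by move=> ag y; rewrite (agree_ball _ ag) => /ag. Qed.

Lemma agree_move e e' r1 r2 x y :
  agree e e' (r1 + r2) x -> ball e r1 x y -> agree e e' r2 y.
Proof. by move=> ag xy z yz; apply: ag; apply: ball_trans yz. Qed.

(** * The spanner as a function of an environment, and its locality *)

(* The conditions [ball e r x y] below always look outwards from the vertex at
   which a predicate is evaluated: this is what makes the predicate depend only
   on the part of [e] around that vertex. *)
Section LocalSpanner.
(** [D] is the unit of the radii, [M] the number of random bits per phase, [B] the range of a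
    cluster leader, [sg] the length of a growth step and [s] the bound on the number of such
    steps. *)
Variables (R : realType) (k D M B s sg : nat) (eps : R).

(** The number of leading ones in the [j]-th block of [M] bits: a geometric variable truncated at
    [M]. *)
Definition reach (e : env) (j u : nat) : nat :=
  find (fun t => ~~ nth false (e u).2 (j * M + t)) (iota 0 M).

Definition leader (e : env) (j v u : nat) : Prop :=
  ball e (D * reach e j u) v u /\
  forall u', ball e (D * reach e j u') v u' -> u' <= u.

(** As the predecessor of 0 is 0, positivity of the reach is what excludes a ball that consists of
    its last layer only. *)
Definition cluster (e : env) (j u v : nat) : Prop :=
  [/\ leader e j v u, 0 < reach e j u & ball e (D * (reach e j u).-1) v u].

Definition near (e : env) (j u r x : nat) : Prop :=
  exists2 v, ball e r x v & cluster e j u v.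

Definition kpath (X : seq (nat * nat)) (x y : nat) : Prop :=
  exists p, [/\ path (fun a b => ((a, b) \in X) || ((b, a) \in X)) x p,
                last x p = y & size p <= k].

Definition todo (e : env) (c : nat -> nat -> Prop) (j u r x y : nat) : Prop :=
  [/\ y \in (e x).1, ~ c x y & near e j u r x].

Definition edges_within (e : env) (u : nat) (X : seq (nat * nat)) : Prop :=
  forall a b, (a, b) \in X -> ball e B u a /\ b \in (e a).1.

Definition covers (e : env) (c : nat -> nat -> Prop) (j u r : nat)
    (X : seq (nat * nat)) : Prop :=
  forall x y, ball e B u x -> todo e c j u r x y -> kpath X x y.

(** [S] pairs a radius, in units of [sg], with a solution for the next larger radius. *)
Definition good (e : env) (c : nat -> nat -> Prop) (j u : nat)
    (S : nat * seq (nat * nat)) : Prop :=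
  [/\ S.1 <= s, edges_within e u S.2, covers e c j u (S.1.+1 * sg) S.2
    & forall Y, edges_within e u Y -> covers e c j u (S.1 * sg) Y ->
        ((size S.2)%:R <= (1 + eps) * (size Y)%:R :> R)%R].

(** The result depends on the predicate alone, so vertices that reconstruct the same [good] agree on
    a solution without further communication. *)
Definition choose_or {T : Type} (d : T) (P : T -> Prop) : T :=
  if pselect (exists x, P x) is left h then sval (cid h) else d.

Definition sol (e : env) (c : nat -> nat -> Prop) (j u : nat) :
    seq (nat * nat) :=
  (choose_or (0, [::]) (good e c j u)).2.

Fixpoint covered (e : env) (j : nat) : nat -> nat -> Prop :=
  if j is j'.+1 then fun x y =>
    covered e j' x y \/
    exists2 u, ball e B x u & kpath (sol e (covered e j') j' u) x y
  else fun _ _ => False.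

Definition psol (e : env) (j u : nat) := sol e (covered e j) j u.

Definition selected (e : env) (q x y : nat) : Prop :=
  exists j u, [/\ j < q, ball e B x u & (x, y) \in psol e j u].

Lemma choose_orP {T : Type} (d : T) (P : T -> Prop) :
  (exists x, P x) -> P (choose_or d P).
Proof. by move=> h; rewrite /choose_or; case: pselect => // h'; case: (cid h'). Qed.

Lemma reach_leq e j u : reach e j u <= M.
Proof. by rewrite -[leqRHS](size_iota 0 M); apply: find_size. Qed.

Lemma reach_eq e e' j u : e u = e' u -> reach e j u = reach e' j u.
Proof. by rewrite /reach => ->. Qed.

Lemma leader_local e e' j v u :
  agree e e' (D * M) v -> leader e j v u -> leader e' j v u.
Proof.
move=> ag [vu umax].
have leDM u' : D * reach e j u' <= D * M by rewrite leq_mul2l reach_leq orbT.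
have E : e u = e' u by apply: ag; apply: ball_leq vu.
split=> [|u' vu'].
  rewrite -(reach_eq _ E) (@agree_ball e) //; exact: agree_leq ag.
have leDM' : D * reach e' j u' <= D * M by rewrite leq_mul2l reach_leq orbT.
move: vu'; rewrite (@agree_ball e); last exact: agree_leq ag.
move=> vu'; apply: umax; rewrite (@reach_eq e e') //.
by apply: ag; apply: ball_leq vu'.
Qed.

Lemma cluster_local e e' j v u :
  agree e e' (D * M) v -> cluster e j u v -> cluster e' j u v.
Proof.
move=> ag [L r0 vu].
have le : D * (reach e j u).-1 <= D * M.
  by rewrite leq_mul2l (leq_trans (leq_pred _) (reach_leq _ _ _)) orbT.
have E : e u = e' u by apply: ag; apply: ball_leq vu.
split; first exact: leader_local L.
  by rewrite -(reach_eq _ E).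
rewrite -(reach_eq _ E) (@agree_ball e) //; exact: agree_leq ag.
Qed.

Lemma todo_local e e' (c c' : nat -> nat -> Prop) j u r x y :
  agree e e' (r + D * M) x -> (c' x y -> c x y) ->
  todo e c j u r x y -> todo e' c' j u r x y.
Proof.
move=> ag cc' [xy nc [v xv cl]]; split.
- by rewrite -(ag x (ball_refl _ _ _)).
- by move/cc'.
exists v; last by apply: cluster_local cl; apply: agree_move xv.
by rewrite (@agree_ball e) //; apply: agree_leq ag; apply: leq_addr.
Qed.

Lemma edges_within_local e e' u X :
  agree e e' B u -> edges_within e u X -> edges_within e' u X.
Proof.
move=> ag wX a b /wX[ua ab]; split; first by rewrite (agree_ball _ ag).
by rewrite -(ag a ua).
Qed.

Hypothesis leB : s.+1 * sg + D * M <= B.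

Lemma covers_local e e' (c c' : nat -> nat -> Prop) j u r X :
  r <= s.+1 * sg ->
  agree e e' (B + B) u ->
  (forall x y, ball e B u x -> c x y -> c' x y) ->
  covers e c j u r X -> covers e' c' j u r X.
Proof.
move=> rs ag cc' cov x y ux.
rewrite (agree_ball _ (agree_leq (leq_addr _ _) ag)) in ux.
move=> td; apply: cov => //; apply: todo_local td; last exact: cc'.
apply: agreeC; apply: (@agree_leq _ _ _ B); last exact: agree_move ux.
by apply: leq_trans leB; rewrite leq_add2r.
Qed.

Lemma good_local e e' (c c' : nat -> nat -> Prop) j u S :
  agree e e' (B + B) u ->
  (forall x y, ball e B u x -> (c x y <-> c' x y)) ->
  good e c j u S -> good e' c' j u S.
Proof.
move=> ag cc' [Ss wS cS mS].
have agB : agree e e' B u by apply: agree_leq ag; apply: leq_addr.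
split=> //; first exact: edges_within_local wS.
  apply: covers_local ag _ cS; first by rewrite leq_mul2r ltnS Ss orbT.
  by move=> x y /(cc' x y)[].
move=> Y wY cY; apply: mS; first exact: edges_within_local (agreeC agB) wY.
apply: covers_local (agreeC ag) _ cY.
  by rewrite leq_mul2r (leq_trans Ss) ?orbT.
by move=> x y; rewrite (agree_ball _ agB) => /(cc' x y)[].
Qed.

(** A solution at [u] concerns edges that start in the [B]-ball of [u], and testing such an edge
    looks at most [B] further. *)
Lemma sol_local e e' (c c' : nat -> nat -> Prop) j u :
  agree e e' (B + B) u ->
  (forall x y, ball e B u x -> (c x y <-> c' x y)) ->
  sol e c j u = sol e' c' j u.
Proof.
move=> ag cc'; rewrite /sol; suff -> : good e c j u = good e' c' j u by [].
apply/funext => S; apply/propext; split; first exact: good_local.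
apply: good_local (agreeC ag) _ => x y.
rewrite (agree_ball _ (agree_leq (leq_addr _ _) ag)) => /(cc' x y) E.
by split=> /E.
Qed.

Lemma covered_psol_local j e e' :
  (forall x y, agree e e' (j * (3 * B)) x ->
     covered e j x y <-> covered e' j x y) ->
  forall u, agree e e' (j * (3 * B) + 2 * B) u -> psol e j u = psol e' j u.
Proof.
move=> IH u ag; apply: sol_local; first by apply: agree_leq ag; lia.
move=> x y ux; apply: IH; apply: agree_move ux; apply: agree_leq ag; lia.
Qed.

(** Each phase adds [3 * B] to the radius: [B] to get to a leader, [2 * B] for the solution at that
    leader. *)
Lemma covered_local j e e' x y :
  agree e e' (j * (3 * B)) x -> covered e j x y <-> covered e' j x y.
Proof.
elim: j e e' x y => [//|j IH] e e' x y ag /=.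
rewrite -(IH e e'); last by apply: agree_leq ag; lia.
have agB : agree e e' B x by apply: agree_leq ag; lia.
suff E u : ball e B x u ->
    sol e (covered e j) j u = sol e' (covered e' j) j u.
  split=> -[|[u xu ku]]; [by left|right|by left|right].
    by exists u; rewrite ?(agree_ball _ agB) // -E.
  by rewrite (agree_ball _ agB) in xu; exists u; rewrite // E.
move=> xu; apply: (covered_psol_local (IH e e')).
by apply: agree_move xu; apply: agree_leq ag; lia.
Qed.

Lemma selected_local q e e' x y :
  agree e e' (q * (3 * B)) x -> selected e q x y -> selected e' q x y.
Proof.
move=> ag [j [u [jq xu xy]]].
have le : j.+1 * (3 * B) <= q * (3 * B) by rewrite leq_mul2r jq orbT.
exists j, u; split=> //.
  rewrite (@agree_ball e) //; apply: agree_leq ag; move: le; lia.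
rewrite -(@covered_psol_local j e e') // => [? ?|]; first exact: covered_local.
by apply: agree_move xu; apply: agree_leq ag; move: le; lia.
Qed.

End LocalSpanner.

(** * The environment of a network *)

Section GraphEnv.
Variables (G : sgraph) (id : G -> nat) (tape : G -> seq bool).
Hypothesis id_inj : injective id.

Definition graph_env : env := fun i =>
  if [pick v | id v == i] is Some v
  then ([seq id u | u <- nbrs id v], tape v) else ([::], [::]).

Lemma mem_nbrs v u : (u \in nbrs id v) = adj v u.
Proof. by rewrite mem_sort mem_enum. Qed.

Lemma graph_envE v : graph_env (id v) = ([seq id u | u <- nbrs id v], tape v).
Proof.
rewrite /graph_env; case: pickP => [u /eqP/id_inj ->//|/(_ v)].
by rewrite eqxx.
Qed.

Lemma graph_env_adj v u : (id u \in (graph_env (id v)).1) = adj v u.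
Proof. by rewrite graph_envE mem_map // mem_nbrs. Qed.

Lemma graph_env_nbrP x y :
  y \in (graph_env x).1 -> exists v u, [/\ x = id v, y = id u & adj v u].
Proof.
rewrite {1}/graph_env; case: pickP => // v /eqP <- /mapP[u vu ->].
by exists v, u; rewrite -mem_nbrs.
Qed.

Lemma graph_env_sym x y :
  y \in (graph_env x).1 -> x \in (graph_env y).1.
Proof.
case/graph_env_nbrP=> v [u [-> -> vu]].
by rewrite graph_env_adj adj_sym.
Qed.

Lemma graph_env_ball r v y : ball graph_env r (id v) y -> exists u, y = id u.
Proof.
elim: r v => [|r IH] v /=; first by rewrite orbF => /eqP <-; exists v.
case/orP=> [/eqP <-|/hasP[z /graph_env_nbrP[v' [u [_ -> _]]]]]; first by exists v.
exact: IH.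
Qed.

End GraphEnv.

(** * Simulating a local function by flooding *)

Record gather_state := GatherState {
  g_bound : nat;
  g_time : nat;
  g_id : nat;
  g_nbrs : seq nat;
  g_known : seq (nat * vrecord)
}.

(** An identifier missing from the list gets an out-of-range index and hence the empty record. *)
Definition env_of (K : seq (nat * vrecord)) : env := fun i =>
  nth ([::], [::]) [seq x.2 | x <- K] (index i [seq x.1 | x <- K]).

(* An isolated vertex halts at once: on the one-vertex network the running time
   has to be bounded by a constant that does not depend on [eps]. *)
Definition gather (rb T : nat -> nat) (F : nat -> env -> nat -> pred nat) :
    local_alg :=
  {| state := gather_state;
     msg := seq (nat * vrecord);
     rbits := rb;
     init := fun N i nb w => GatherState N 0 i nb [:: (i, (nb, tval w))];
     send := fun s _ => g_known s;
     recv := fun s inbox => GatherState (g_bound s) (g_time s).+1 (g_id s)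
       (g_nbrs s) (g_known s ++ flatten [seq m.2 | m <- inbox]);
     output := fun s =>
       if (g_time s == T (g_bound s)) || nilp (g_nbrs s)
       then Some (F (g_bound s) (env_of (g_known s)) (g_id s)) else None |}.

Section Gather.
Variables (rb T : nat -> nat) (F : nat -> env -> nat -> pred nat).
Variables (G : sgraph) (id : G -> nat) (N : nat).
Hypothesis id_inj : injective id.
Notation A := (gather rb T F).
Variable w : rand_tapes A G N.
Notation e := (graph_env id (fun v => tval (w v))).

Lemma gather_isolated : (forall v, nbrs id v = [::]) -> all_halted id w 0.
Proof.
by move=> iso v; rewrite /halted /= iso /= orbT.
Qed.

Hypothesis nbrs_nil : forall v, nbrs id v != [::].

(** Since every vertex has a neighbour, none halts before time [T N]; each round therefore delivers
    the full lists of all neighbours and extends the known ball by one hop. *)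
Lemma gather_config t v : t <= T N ->
  config id w t v =
    GatherState N t (id v) [seq id u | u <- nbrs id v]
      (g_known (config id w t v)) /\
  forall x, (x \in g_known (config id w t v)) =
    [exists u, (x == (id u, e (id u))) && ball e t (id v) (id u)].
Proof.
elim: t v => [|t IH] v tT.
  split=> // x; rewrite /= mem_seq1; apply/eqP/existsP => [->|[u]].
    by exists v; rewrite graph_envE // !eqxx.
  by rewrite orbF => /andP[/eqP-> /eqP/id_inj <-]; rewrite graph_envE.
have nh u : halted (config id w t u) = false.
  have [-> _] := IH u (ltnW tT).
  rewrite /halted /= (ltn_eqF tT) /nilp size_map size_eq0.
  by rewrite (negbTE (nbrs_nil u)).
rewrite /config iterS -/(config id w t) /round nh.
have -> : [seq u <- nbrs id v | ~~ halted (config id w t u)] = nbrs id v.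
  by apply/all_filterP/allP => u _; rewrite nh.
have [{1 2 3 4}-> Kv] := IH v (ltnW tT); split=> //= x.
rewrite mem_cat Kv -map_comp /=; apply/orP/existsP.
- case=> [/existsP[u /andP[xu vu]]|/flattenP[K /mapP[u vu ->]]].
    by exists u; rewrite xu; apply: (ball_leq (leqnSn t)) vu.
  rewrite /= (IH u (ltnW tT)).2 => /existsP[z /andP[xz uz]].
  exists z; rewrite xz; apply/orP; right; apply/hasP; exists (id u) => //.
  by rewrite graph_env_adj // -(mem_nbrs id).
case=> u /andP[xu /orP[/eqP vu|/hasP[z vz zu]]].
  by left; apply/existsP; exists u; rewrite xu vu ball_refl.
right; have [v' [z' [vv' ez vz']]] := graph_env_nbrP vz.
rewrite {}ez in vz zu; move/id_inj: vv' => vv'; subst v'.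
apply/flattenP; exists (g_known (config id w t z')).
  by apply/mapP; exists z' => //; rewrite mem_nbrs.
by rewrite (IH z' (ltnW tT)).2; apply/existsP; exists u; rewrite xu.
Qed.

Lemma gather_halted : all_halted id w (T N).
Proof.
by move=> v; have [-> _] := gather_config v (leqnn (T N)); rewrite /halted /= eqxx.
Qed.

Lemma gather_selects v i :
  (forall e' x y, agree e e' (T N) x -> F N e x y = F N e' x y) ->
  selects (config id w (T N) v) i = F N e (id v) i.
Proof.
move=> locF; have [E K] := gather_config v (leqnn (T N)).
rewrite E /selects /= eqxx /=; apply/esym/locF => y vy.
have [u yu] := graph_env_ball vy; rewrite {y}yu in vy *.
set L := g_known _ in K *.
have uL : (id u, e (id u)) \in L by rewrite K; apply/existsP; exists u; rewrite eqxx.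
have iL : id u \in [seq x.1 | x <- L] by apply/mapP; exists (id u, e (id u)).
(* Entries may repeat in [L], but all of them carry true records, so the first one found is
   right. *)
rewrite /env_of; set i0 := index _ _.
have i0L : i0 < size L by rewrite -(size_map fst) index_mem.
have := mem_nth (0, ([::], [::])) i0L; rewrite K => /existsP[u' /andP[/eqP nu' _]].
rewrite (nth_map (0, ([::], [::]))) // nu' /=.
have := nth_index 0 iL; rewrite -/i0 (nth_map (0, ([::], [::]))) // nu' /=.
by move=> ->.
Qed.

Lemma gather_output_edges :
  (forall e' x y, agree e e' (T N) x -> F N e x y = F N e' x y) ->
  output_edges id w (T N) =
    [set [set u; v] | u in [set: G], v in [set: G]
       & adj u v && F N e (id u) (id v)].
Proof.
move=> locF; apply/setP => h.
by apply/imset2P/imset2P => -[u v uT]; rewrite !inE /= => uv ->;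
  exists u v => //; move: uv; rewrite !inE /= gather_selects.
Qed.

End Gather.

(** * Edges as two-element sets, and minimum spanners *)

Lemma set2_eq (T : finType) (a b c d : T) :
  [set a; b] = [set c; d] -> (a = c /\ b = d) \/ (a = d /\ b = c).
Proof.
move=> E; have := set21 a b; have := set22 a b; rewrite E !inE.
have := set21 c d; have := set22 c d; rewrite -E !inE.
by do 4![case/orP=> /eqP ?]; subst; tauto.
Qed.

Lemma mem_edges (G : sgraph) (u v : G) : ([set u; v] \in edges G) = adj u v.
Proof.
apply/imset2P/idP => [[a b _]|uv]; last by exists u v; rewrite ?inE.
rewrite !inE /= => ab /set2_eq[[-> ->]//|[-> ->]].
by rewrite adj_sym.
Qed.

Lemma edgesP (G : sgraph) (h : {set G}) :
  h \in edges G -> exists a b, h = [set a; b] /\ adj a b.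
Proof. by case/imset2P=> a b _; rewrite !inE => ab ->; exists a, b. Qed.

Lemma exists_min_kspanner (k : nat) (G : sgraph) :
  0 < k -> exists H : {set {set G}}, min_kspanner k H.
Proof.
move=> k0; have kE : `[< kspanner k (edges G) >].
  apply/asboolP; split=> // u v uv; exists [:: v]; split=> //=.
  by rewrite mem_edges uv.
case: (@arg_minnP _ (edges G) (fun H => `[< kspanner k H >]) (fun H => #|H|) kE) => H /asboolP kH minH.
by exists H; split=> // H' kH'; apply: minH; apply/asboolP.
Qed.

Lemma card_bigcup_leq (I T : finType) (F : I -> {set T}) :
  #|\bigcup_i F i| <= \sum_i #|F i|.
Proof.
elim/big_rec2: _ => [|i n A _ le]; first by rewrite cards0.
by apply: leq_trans (leq_card_setU _ _) _; rewrite leq_add2l.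
Qed.

(** * Correctness and approximation ratio, given that all vertices are clustered *)

Section Approximation.
Variables (R : realType) (k D M B s sg q : nat) (eps : R).
Variables (G : sgraph) (id : G -> nat) (tape : G -> seq bool).
Hypothesis id_inj : injective id.
Hypothesis k_gt0 : 0 < k.
Hypothesis sgE : sg = 2 * k.
Hypothesis leD : 2 * (s * sg) + 2 * k <= D.
Hypothesis leB : s.+1 * sg + D * M + k <= B.
Hypothesis eps_gt0 : (0 < eps)%R.
Hypothesis growth : ((#|G| ^ 2)%:R < (1 + eps) ^+ s)%R.

Notation e := (graph_env id tape).
Notation esym := (@graph_env_sym G id tape id_inj).
Notation covered j := (covered k D M B s sg eps e j).
Notation psol j u := (psol k D M B s sg eps e j u).
Notation cluster := (cluster D M e).
Notation near := (near D M e).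
Notation todo := (todo D M e).
Notation kpath := (kpath k).
Notation covers := (covers k D M B e).
Notation edges_within := (edges_within B e).
Notation good := (good k D M B s sg eps e).

(** Lying outside the last layer, [v'] leaves [D] more steps to its leader, which thus also reaches
    [v] and cannot exceed the leader of [v]. Symmetry gives equality. *)
Lemma cluster_sep j u u' v v' :
  cluster j u v -> cluster j u' v' -> ball e D v v' -> u = u'.
Proof.
have main u1 u2 v1 v2 : cluster j u1 v1 -> cluster j u2 v2 ->
    ball e D v1 v2 -> u2 <= u1.
  move=> [[_ max1] _ _] [_ r0 b2] b12; apply: max1.
  have -> : D * reach M e j u2 = D + D * (reach M e j u2).-1.
    by rewrite -{1}(prednK r0) mulnS.
  exact: ball_trans b12 b2.
move=> c c' b; apply/eqP; rewrite eqn_leq (main _ _ _ _ c c' b).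
by rewrite (main _ _ _ _ c' c) // (ball_sym esym).
Qed.

Lemma near_ball j u r x : near j u r x -> ball e (r + D * M) x u.
Proof.
case=> v xv [[vu _] _ _]; apply: ball_trans xv _.
by apply: ball_leq vu; rewrite leq_mul2l reach_leq orbT.
Qed.

Lemma near_ballB j u r x : r <= s.+1 * sg -> near j u r x -> ball e B x u.
Proof. by move=> rs /near_ball; apply: ball_leq; move: leB; lia. Qed.

Definition all_edges (u : nat) : seq (nat * nat) :=
  [seq (id p.1, id p.2) | p <- enum {: G * G}
     & adj p.1 p.2 && ball e B u (id p.1)].

Lemma size_all_edges u : size (all_edges u) <= #|G| ^ 2.
Proof.
rewrite size_map size_filter; apply: leq_trans (count_size _ _) _.
by rewrite -cardE card_prod.
Qed.

Lemma edges_within_all u : edges_within u (all_edges u).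
Proof.
move=> a b /mapP[[x y]]; rewrite mem_filter /= => /andP[/andP[xy ux] _] [-> ->].
by rewrite graph_env_adj.
Qed.

Lemma covers_all c j u r : covers c j u r (all_edges u).
Proof.
move=> x y ux [/graph_env_nbrP[a [b [xa yb ab]]] _ _]; subst x y.
exists [:: id b]; split=> //=; rewrite andbT; apply/orP; left; apply/mapP.
by exists (a, b); rewrite // mem_filter /= ab ux mem_enum.
Qed.

Lemma exists_min_cover c j u r : exists X,
  [/\ edges_within u X, covers c j u r X
    & forall Y, edges_within u Y -> covers c j u r Y -> size X <= size Y].
Proof.
pose P n := `[< exists X, [/\ edges_within u X, covers c j u r X & size X = n] >].
have exP : exists n, P n.
  exists (size (all_edges u)); apply/asboolP; exists (all_edges u).
  by split=> //; [apply: edges_within_all | apply: covers_all].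
case: (ex_minnP exP) => n /asboolP[X [wX cX <-]] minn; exists X; split=> // Y wY cY.
by apply: minn; apply/asboolP; exists Y.
Qed.

(* If no radius were good, the optimum would grow by a factor [1 + eps] from
   each radius to the next and exceed the number of edges. *)
Lemma exists_good c j u : exists S, good c j u S.
Proof.
have [X XP] := choice (fun i => exists_min_cover c j u (i * sg)).
apply: contrapT => nogood.
have step i : i <= s ->
    ((1 + eps) * (size (X i))%:R < (size (X i.+1))%:R :> R)%R.
  move=> le_is; rewrite ltNge; apply/negP => le; apply: nogood.
  exists (i, X i.+1); have [wX cX minX] := XP i.+1; split=> // Y wY cY.
  apply: le_trans le _; apply: ler_wpM2l; first by rewrite addr_ge0 // ltW.
  by have [_ _ min] := XP i; rewrite ler_nat min.
have grow i : i <= s -> ((1 + eps) ^+ i <= (size (X i.+1))%:R :> R)%R.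
  elim: i => [|i IH] le_is.
    (* Strict growth out of [X 0] forces an edge into [X 1], which starts the induction. *)
    rewrite expr0 (ler_nat _ 1) -(ltr_nat R); apply: le_lt_trans (step 0 le_is).
    by rewrite mulr_ge0 // addr_ge0 // ltW.
  apply: le_trans (ltW (step _ le_is)); rewrite exprS.
  by apply: ler_wpM2l (IH (ltnW le_is)); rewrite addr_ge0 // ltW.
have := lt_le_trans growth (grow s (leqnn s)); rewrite ltr_nat => lt.
have [_ _ min] := XP s.+1; have := min _ (@edges_within_all u) (@covers_all _ _ _ _).
by have := size_all_edges u; lia.
Qed.

(** The number of growth steps chosen together with [psol j u]; it serves the analysis only. *)
Definition radius j u : nat := (choose_or (0, [::]) (good (covered j) j u)).1.

Lemma psol_good j u : good (covered j) j u (radius j u, psol j u).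
Proof.
by have [] := choose_orP (0, [::]) (exists_good (covered j) j u); split.
Qed.

Lemma covered_leq i j x y : i <= j -> covered i x y -> covered j x y.
Proof.
move=> le c; rewrite -(subnKC le); elim: (_ - _) => [|d IH]; first by rewrite addn0.
by rewrite addnS; left.
Qed.

(** The solution covers one step beyond the chosen radius, and [leB] puts [u] into the [B]-ball of
    [x], where [covered] looks for it. *)
Lemma todo_covered j u x y :
  todo (covered j) j u ((radius j u).+1 * sg) x y -> covered j.+1 x y.
Proof.
move=> td; have [rs _ cX _] := psol_good j u; rewrite /= in rs.
have xu : ball e B x u.
  by have [_ _ nr] := td; apply: near_ballB nr; rewrite leq_mul2r ltnS rs orbT.
by right; exists u => //; apply: cX td; apply: ball_sym esym _.
Qed.

(** A clustered vertex is at distance 0 from its cluster, so the phase that clusters it spans its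
    remaining edges. *)
Lemma covered_all x y :
  (exists j u, j < q /\ cluster j u (id x)) -> adj x y ->
  covered q (id x) (id y).
Proof.
move=> [j [u [jq cl]]] xy.
have [c|nc] := pselect (covered j (id x) (id y)); first exact: covered_leq (ltnW jq) c.
apply: (covered_leq jq); apply: (@todo_covered j u); split=> //.
  by rewrite graph_env_adj.
by exists (id x) => //; apply: ball_refl.
Qed.

Lemma covered_path j x y : covered j x y ->
  exists i u, [/\ i < j, ball e B x u & kpath (psol i u) x y].
Proof.
elim: j => [//|j IH] [/IH[i [u [ij xu p]]]|[u xu p]].
  by exists i, u; split=> //; apply: leqW.
by exists j, u.
Qed.

Definition chosen_edges : {set {set G}} :=
  [set [set u; v] | u in [set: G], v in [set: G]
     & adj u v && `[< selected k D M B s sg eps e q (id u) (id v) >]].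

Lemma psol_chosen j u a b : j < q -> (a, b) \in psol j u ->
  exists a' b', [/\ a = id a', b = id b' & [set a'; b'] \in chosen_edges].
Proof.
move=> jq abX; have [_ wX _ _] := psol_good j u.
have [ua ab] := wX _ _ abX.
have [a' [b' [ea eb ab']]] := graph_env_nbrP ab.
exists a', b'; split=> //; apply/imset2P; exists a' b'; rewrite ?inE //= ab'.
apply/asboolP; exists j, u; split=> //; last by rewrite -ea -eb.
by rewrite -ea; apply: ball_sym esym _.
Qed.

Lemma kspanner_chosen :
  (forall v, exists j u, j < q /\ cluster j u (id v)) ->
  kspanner k chosen_edges.
Proof.
move=> cl; split.
  apply/subsetP => h /imset2P[u v _]; rewrite !inE /= => /andP[uv _] ->.
  by rewrite mem_edges.
move=> x y xy; have [j [u [jq xu]]] := covered_path (covered_all (cl x) xy).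
case=> p [pX py pk].
(* Pairs in a solution are edges of [G], so a path of identifiers lifts to a path of vertices. *)
suff [p' [p'H p'E]] : exists p', path (fun a b => [set a; b] \in chosen_edges) x p'
    /\ [seq id z | z <- p'] = p.
  exists p'; split=> //; last by rewrite -(size_map id) p'E.
  by apply: id_inj; rewrite -last_map p'E py.
elim: p x pX {py pk xy xu} => [|z p IH] x /=; first by exists [::].
case/andP=> xz pX.
have [z' [ez xz']] : exists z', z = id z' /\ [set x; z'] \in chosen_edges.
  case/orP: xz => /(psol_chosen jq)[a [b [ea eb ab]]].
    by exists b; rewrite (id_inj ea).
  by exists a; rewrite (id_inj eb) setUC.
subst z; have [p' [p'H p'E]] := IH _ pX.
by exists (z' :: p'); rewrite /= xz' p'H p'E.
Qed.

Section Charge.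
Variable Hmin : {set {set G}}.
Hypothesis Hmin_spanner : kspanner k Hmin.

(* The part of [Hmin] that pays for [psol j (id u)]. *)
Definition share (p : 'I_q * G) : {set {set G}} :=
  [set h in Hmin | `[< exists x y,
     todo (covered p.1) p.1 (id p.2) (radius p.1 (id p.2) * sg) (id x) y /\
     forall a, a \in h -> ball e k (id x) (id a) >]].

(** A common edge puts the start points of two pending edges within [2 * k]. In different phases,
    the later edge would lie within one more step [sg = 2 * k] of the earlier cluster and would
    already be spanned. In the same phase, the clusters would be within [D] by [leD], hence equal by
    [cluster_sep]. *)
Lemma share_disjoint h p p' : h \in share p -> h \in share p' -> p = p'.
Proof.
have close p1 p2 : h \in share p1 -> h \in share p2 -> exists x1 y1 x2 y2,
  [/\ todo (covered p1.1) p1.1 (id p1.2) (radius p1.1 (id p1.2) * sg) x1 y1,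
      todo (covered p2.1) p2.1 (id p2.2) (radius p2.1 (id p2.2) * sg) x2 y2
    & ball e (2 * k) x2 x1].
  rewrite !inE => /andP[hH /asboolP[x1 [y1 [t1 b1]]]].
  move=> /andP[_ /asboolP[x2 [y2 [t2 b2]]]].
  exists (id x1), y1, (id x2), y2; split=> //.
  have [a [b [eh _]]] := edgesP (subsetP Hmin_spanner.1 h hH).
  have ah : a \in h by rewrite eh set21.
  rewrite mul2n -addnn; apply: ball_trans (b2 a ah) _.
  exact: (ball_sym esym (b1 a ah)).
have ltF (p1 p2 : 'I_q * G) : p1.1 < p2.1 -> h \in share p1 -> h \in share p2 -> False.
  move=> lt h1 h2; have [x1 [y1 [x2 [y2 [[_ _ [v x1v cl]] [xy2 nc2 _]]]]]] := close _ _ h1 h2.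
  move=> b21; apply: nc2; apply: (covered_leq lt).
  have [c|nc] := pselect (covered p1.1 x2 y2); first by left.
  apply: (@todo_covered _ (id p1.2)); split=> //; exists v => //.
  rewrite mulSn sgE; apply: ball_trans b21 _; by rewrite -sgE.
move=> hp hp'; have E1 : p.1 = p'.1.
  apply: val_inj => /=; case: (ltngtP p.1 p'.1) => //.
    by move=> lt; case: (ltF _ _ lt hp hp').
  by move=> lt; case: (ltF _ _ lt hp' hp).
have [x1 [y1 [x2 [y2 [[_ _ [v1 xv1 c1]] [_ _ [v2 xv2 c2]] b21]]]]] := close _ _ hp hp'.
case: p p' E1 c1 c2 xv1 xv2 {hp hp'} => [j u] [j' u'] /= E1; subst j'.
move=> c1 c2 xv1 xv2.
congr (_, _); apply: id_inj; apply: cluster_sep c1 c2 _.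
have [r1 _ _ _] := psol_good j (id u); have [r2 _ _ _] := psol_good j (id u').
have le1 : radius j (id u) * sg <= s * sg by rewrite leq_mul2r r1 orbT.
have le2 : radius j (id u') * sg <= s * sg by rewrite leq_mul2r r2 orbT.
apply: ball_leq (ball_trans (ball_trans (ball_sym esym xv1) (ball_sym esym b21)) xv2).
by move: leD; lia.
Qed.

(** Double counting: by disjointness each edge of [Hmin] contributes to at most one share. *)
Lemma sum_share : \sum_p #|share p| <= #|Hmin|.
Proof.
rewrite -sum1_card.
under eq_bigr => p _.
  rewrite -sum1_card big_mkcond /=.
  rewrite (bigID (mem Hmin)) /= [X in _ + X]big1 ?addn0; last first.
    by move=> h /negbTE hH; rewrite inE hH.
  over.
rewrite exchange_big /=; apply: leq_sum => h _.
rewrite -big_mkcond /= sum1_card; apply/card_le1_eqP => p p'.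
move=> hp hp'; exact: share_disjoint hp' hp.
Qed.

(** The share, with its edges oriented arbitrarily, is itself a cover for the chosen radius: a path
    of [Hmin] replacing a pending edge at [x] stays within [k] of [x]. The optimality clause of
    [good] then applies. *)
Lemma psol_share (p : 'I_q * G) :
  ((size (psol p.1 (id p.2)))%:R <= (1 + eps) * #|share p|%:R :> R)%R.
Proof.
case: p => j u /=; have [rs _ _ minX] := psol_good j (id u).
have rep (h : {set G}) : exists ab : nat * nat, h \in edges G ->
    exists a b, [/\ h = [set a; b], adj a b & ab = (id a, id b)].
  have [hE|_] := boolP (h \in edges G); last by exists (0, 0).
  have [a [b [-> ab]]] := edgesP hE; exists (id a, id b) => _.
  by exists a, b.
have [f fP] := choice rep.
pose Y := [seq f h | h <- enum (share (j, u))].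
have -> : #|share (j, u)| = size Y by rewrite size_map -cardE.
have inE' h : h \in share (j, u) -> h \in edges G.
  by rewrite inE => /andP[/(subsetP Hmin_spanner.1)].
apply: minX.
  move=> a b /mapP[h]; rewrite mem_enum => hs fh.
  have [a' [b' [eh ab' []]]] := fP h (inE' h hs); rewrite -fh => [[-> ->]].
  rewrite graph_env_adj //; split=> //.
  move: hs; rewrite inE => /andP[_ /asboolP[x [y [[_ _ nr] bx]]]].
  apply: ball_leq (ball_trans (ball_sym esym (near_ball nr)) (bx a' _)).
    move: leB; have : radius j (id u) * sg <= s * sg by rewrite leq_mul2r rs orbT.
    by rewrite /=; lia.
  by rewrite eh set21.
move=> x y ux td; have [/graph_env_nbrP[x' [y' [ex ey xy]]] _ _] := td.
subst x y; have [p [pH py pk]] := Hmin_spanner.2 x' y' xy.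
exists [seq id z | z <- p]; split; rewrite ?last_map ?py ?size_map //.
(* Here [d] bounds the distance already walked from [x'], and [d + size p <= k] keeps the rest of
   the path in range of the share. *)
suff gen d z : d + size p <= k -> ball e d (id x') (id z) ->
    path (fun x y => [set x; y] \in Hmin) z p ->
    path (fun a b => ((a, b) \in Y) || ((b, a) \in Y)) (id z) [seq id z | z <- p].
  by apply: (gen 0) pH; rewrite ?ball_refl.
elim: p d z {pH py pk} => [//|z1 p IH] d z /= dk bz /andP[zz1 pH].
have az1 : adj z z1 by rewrite -mem_edges (subsetP Hmin_spanner.1).
have bz1 : ball e d.+1 (id x') (id z1).
  by rewrite -addn1; apply: ball_trans bz (ball_nbr _); rewrite graph_env_adj.
apply/andP; split; last by apply: IH bz1 pH; rewrite addSnnS.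
have hs : [set z; z1] \in share (j, u).
  rewrite inE zz1; apply/asboolP; exists x', (id y'); split=> // a.
  rewrite !inE => /orP[]/eqP->; [apply: ball_leq bz|apply: ball_leq bz1];
    by move: dk; lia.
have fY : f [set z; z1] \in Y by apply: map_f; rewrite mem_enum.
have [a [b [/set2_eq ehz _ ef]]] := fP _ (inE' _ hs).
by rewrite ef in fY; case: ehz => -[-> ->]; rewrite fY ?orbT.
Qed.

Lemma card_chosen : #|chosen_edges| <= \sum_p size (psol (p : 'I_q * G).1 (id p.2)).
Proof.
pose E (p : 'I_q * G) := [set ab : G * G | (id ab.1, id ab.2) \in psol p.1 (id p.2)].
apply: (@leq_trans (\sum_p #|[set [set ab.1; ab.2] | ab in E p]|)).
  apply: leq_trans (card_bigcup_leq _); apply/subset_leq_card/subsetP => h.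
  case/imset2P=> a b _; rewrite !inE /= => /andP[ab /asboolP[j [u [jq au abX]]]] ->.
  have [u' eu] := graph_env_ball au; subst u.
  apply/bigcupP; exists (Ordinal jq, u') => //; apply/imsetP.
  by exists (a, b); rewrite // inE.
apply: leq_sum => p _; apply: leq_trans (leq_imset_card _ _) _.
rewrite cardE -(size_map (fun ab => (id ab.1, id ab.2))); apply: uniq_leq_size.
  rewrite map_inj_uniq ?enum_uniq // => -[a b] [c d] /= [].
  by move=> /id_inj -> /id_inj ->.
by move=> ab /mapP[x]; rewrite mem_enum inE => xE ->.
Qed.

Lemma card_chosen_share : (#|chosen_edges|%:R <= (1 + eps) * #|Hmin|%:R :> R)%R.
Proof.
apply: (@le_trans _ _ (\sum_p ((1 + eps) * #|share p|%:R))%R).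
  apply: (@le_trans _ _ (\sum_p size (psol (p : 'I_q * G).1 (id p.2)))%:R).
    by rewrite ler_nat card_chosen.
  by rewrite natr_sum; apply: ler_sum => p _; apply: psol_share.
rewrite -mulr_sumr -natr_sum; apply: ler_wpM2l; first by rewrite addr_ge0 // ltW.
by rewrite ler_nat sum_share.
Qed.

End Charge.

Lemma approx_chosen :
  (forall v, exists j u, j < q /\ cluster j u (id v)) ->
  approx_min_kspanner eps k chosen_edges.
Proof.
move=> cl; split; first exact: kspanner_chosen.
have [Hmin minH] := exists_min_kspanner G k_gt0.
by exists Hmin => //; apply: card_chosen_share; case: minH.
Qed.

End Approximation.

(** * Counting tapes by resetting bits *)

Section Bits.
Variables (V : finType) (n : nat).
Notation W := {ffun V -> n.-tuple bool}.

Definition bit (w : W) (x : V * nat) : bool := nth false (w x.1) x.2.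

Definition setbits m (w : W) (p : 'I_m -> V * nat) (b : 'I_m -> bool) : W :=
  [ffun u => [tuple
     if [pick j | p j == (u, val i)] is Some j then b j else tnth (w u) i
     | i < n]].

Lemma bit_setbits m (w : W) (p : 'I_m -> V * nat) b x : x.2 < n ->
  bit (setbits w p b) x = if [pick j | p j == x] is Some j then b j else bit w x.
Proof.
case: x => u i /= lt_in; rewrite /bit /= ffunE.
rewrite (_ : nth _ _ _ = tnth [tuple
     if [pick j | p j == (u, val i)] is Some j then b j else tnth (w u) i
     | i < n] (Ordinal lt_in)); last by rewrite (tnth_nth false).
by rewrite tnth_mktuple /= (tnth_nth false).
Qed.

Lemma bit_inj (w w' : W) : (forall x, x.2 < n -> bit w x = bit w' x) -> w = w'.
Proof.
move=> E; apply/ffunP => u; apply: eq_from_tnth => i.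
by rewrite !(tnth_nth false); apply: (E (u, val i)) => /=.
Qed.

(* Resetting the bits at the positions [pos w] in all [2 ^ m] ways is injective,
   as the positions can be read off the result. *)
Lemma card_fixed_bits m (A : {set W}) (v : bool) (pos : W -> 'I_m -> V * nat) :
  (forall w, w \in A -> injective (pos w)) ->
  (forall w j, w \in A -> (pos w j).2 < n /\ bit w (pos w j) = v) ->
  (forall w b j, w \in A -> pos (setbits w (pos w) b) j = pos w j) ->
  #|A| * 2 ^ m <= #|{: W}|.
Proof.
move=> posI posv posS.
pose f (x : W * {ffun 'I_m -> bool}) := setbits x.1 (pos x.1) x.2.
have -> : #|A| * 2 ^ m = #|setX A [set: {ffun 'I_m -> bool}]|.
  by rewrite cardsX cardsT card_ffun card_bool card_ord.
rewrite -(@card_in_imset _ _ f); first exact: max_card.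
move=> [w b] [w' b'] /[!inE] /andP[wA _] /andP[w'A _]; rewrite /f /= => E.
have Epos j : pos w j = pos w' j.
  by rewrite -(posS w b j) // E posS.
have get (w1 : W) b1 j : w1 \in A -> bit (setbits w1 (pos w1) b1) (pos w1 j) = b1 j.
  move=> w1A; rewrite bit_setbits ?(posv w1 j w1A).1 //.
  case: pickP => [i /eqP/(posI _ w1A) ->//|/(_ j)]; by rewrite eqxx.
congr (_, _); last first.
  by apply/ffunP => j; rewrite -(get w b j wA) E Epos get.
apply: bit_inj => x xn.
have := congr1 (bit^~ x) E; rewrite !bit_setbits //.
(* At a reset position both tapes had the bit [v]; at any other position resetting changed
   nothing. *)
case: pickP => [j /eqP <-|noj].
  by move=> _; rewrite (posv w j wA).2 Epos (posv w' j w'A).2.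
by case: pickP => // j; rewrite -Epos noj.
Qed.

End Bits.

(** * Probability that some vertex is never clustered *)

Section Clustering.
Variables (D M q : nat) (G : sgraph) (id : G -> nat).
Hypothesis id_inj : injective id.
Notation W := {ffun G -> (q * M).-tuple bool}.

Definition tape_env (w : W) : env := graph_env id (fun v => tval (w v)).

Definition clustered (w : W) (v : G) : Prop :=
  exists j u, j < q /\ cluster D M (tape_env w) j u (id v).

Definition reachw (w : W) (j : nat) (u : G) : nat := reach M (tape_env w) j (id u).

Lemma ball_tape (t t' : G -> seq bool) r x y :
  ball (graph_env id t) r x y = ball (graph_env id t') r x y.
Proof.
elim: r x => [//|r IH] x /=; congr (_ || _).
have -> : (graph_env id t x).1 = (graph_env id t' x).1.
  by rewrite /graph_env; case: pickP.
by apply: eq_has => z; apply: IH.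
Qed.

Lemma reachwE w j u :
  reachw w j u = find (fun t => ~~ bit w (u, j * M + t)) (iota 0 M).
Proof. by rewrite /reachw /reach /tape_env graph_envE. Qed.

Lemma reachw_leq w j u : reachw w j u <= M.
Proof. exact: reach_leq. Qed.

Lemma reachw_true w j u t : t < reachw w j u -> bit w (u, j * M + t).
Proof.
move=> lt; have := leq_trans lt (reachw_leq w j u) => ltM.
move: lt; rewrite reachwE => /(before_find 0).
by rewrite nth_iota // add0n => /negbFE.
Qed.

Lemma reachw_false w j u : reachw w j u < M -> ~~ bit w (u, j * M + reachw w j u).
Proof.
move=> lt; have : has (fun t => ~~ bit w (u, j * M + t)) (iota 0 M).
  by rewrite has_find -reachwE size_iota.
by move/(nth_find 0); rewrite -reachwE nth_iota.
Qed.

Lemma reachw_ge w j u d :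
  d <= M -> (forall t, t < d -> bit w (u, j * M + t)) -> d <= reachw w j u.
Proof.
move=> dM ones; rewrite leqNgt; apply/negP => lt.
by have := reachw_false (leq_trans lt dM); rewrite ones.
Qed.

Lemma reachw_eq w w' j u :
  (forall t, t < M -> bit w (u, j * M + t) = bit w' (u, j * M + t)) ->
  reachw w j u = reachw w' j u.
Proof.
move=> E; rewrite !reachwE; apply: eq_in_find => t.
by rewrite mem_iota add0n => /andP[_ /E ->].
Qed.

Section Vertex.
Variable v : G.

Definition competes w j u := ball (tape_env w) (D * reachw w j u) (id v) (id u).

Definition lead w j : G := [arg max_(u > v | competes w j u) id u].

Lemma leadP w j :
  competes w j (lead w j) /\ forall u, competes w j u -> id u <= id (lead w j).
Proof.
rewrite /lead; case: arg_maxnP; first exact: ball_refl.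
by move=> u cu maxu; split.
Qed.

Lemma leadE w j u :
  competes w j u -> (forall u', competes w j u' -> id u' <= id u) -> lead w j = u.
Proof.
move=> cu maxu; have [cl maxl] := leadP w j.
by apply: id_inj; apply/eqP; rewrite eqn_leq maxu // maxl.
Qed.

Lemma leader_lead w j : leader D M (tape_env w) j (id v) (id (lead w j)).
Proof.
have [cl maxl] := leadP w j; split=> // u' vu'.
by have [u E] := graph_env_ball vu'; subst u'; apply: maxl.
Qed.

(** Distance from [v] in units of [D], rounded up and capped at [M]. Measuring it with empty tapes
    makes it visibly independent of the random bits. *)
Definition hops (u : G) : nat :=
  find (fun d => ball (graph_env id (fun=> [::])) (D * d) (id v) (id u)) (iota 0 M).

Lemma hops_leq w d u :
  d < M -> ball (tape_env w) (D * d) (id v) (id u) -> hops u <= d.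
Proof.
move=> dM b; rewrite leqNgt; apply/negP => /(before_find 0).
by rewrite nth_iota // add0n (ball_tape _ (fun v => tval (w v))) b.
Qed.

Lemma hops_ball w u : hops u < M -> ball (tape_env w) (D * hops u) (id v) (id u).
Proof.
move=> lt; rewrite (ball_tape _ (fun=> [::])).
have : has (fun d => ball (graph_env id (fun=> [::])) (D * d) (id v) (id u)) (iota 0 M).
  by rewrite has_find size_iota.
by move/(nth_find 0); rewrite -/(hops u) nth_iota.
Qed.

(** The second condition guarantees a zero bit in the block of each leader; truncated radii are
    counted in [overflow]. *)
Definition unlucky : {set W} :=
  [set w | `[< ~ clustered w v >] & [forall j : 'I_q, reachw w j (lead w j) < M]].

(** A larger reach would leave [v] inside the ball one unit smaller, hence clustered. So the
    position of the first zero bit is determined by the identity of the leader. *)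
Lemma unlucky_hops w (j : 'I_q) :
  w \in unlucky -> reachw w j (lead w j) = hops (lead w j) /\ hops (lead w j) < M.
Proof.
rewrite inE => /andP[/asboolP ncl /forallP /(_ j) rM].
have [cl _] := leadP w j; have le := hops_leq rM cl.
suff E : reachw w j (lead w j) = hops (lead w j) by rewrite -E.
apply/eqP; rewrite eqn_leq le andbT leqNgt; apply/negP => lt; apply: ncl.
exists j, (id (lead w j)); split=> //; split; first exact: leader_lead.
  exact: leq_trans lt.
apply: ball_leq (hops_ball w (leq_ltn_trans le rM)).
rewrite leq_mul2l; apply/orP; right; rewrite -ltnS prednK //.
exact: leq_trans lt.
Qed.

Definition flip_pos (w : W) (j : 'I_q) : G * nat :=
  (lead w j, j * M + hops (lead w j)).

Lemma block_inj i j a b : a < M -> b < M -> i * M + a = j * M + b -> i = j /\ a = b.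
Proof.
move=> aM bM E; have M0 : 0 < M by apply: leq_ltn_trans aM.
have ij : i = j.
  by have := congr1 (divn^~ M) E; rewrite !divnMDl // !divn_small // !addn0.
by split=> //; subst; apply/eqP; rewrite -(eqn_add2l (j * M)) E.
Qed.

Lemma block_ltn i a : i < q -> a < M -> i * M + a < q * M.
Proof.
move=> iq aM; have : i.+1 * M <= q * M by rewrite leq_mul2r iq orbT.
by apply: leq_trans; rewrite mulSn addnC ltn_add2r.
Qed.

(* Raising the first zero bit of the leader of [v] only increases its reach. *)
Lemma flip_pos_setbits w b j :
  w \in unlucky -> flip_pos (setbits w (flip_pos w) b) j = flip_pos w j.
Proof.
move=> wU; set w' := setbits _ _ _.
suff E : lead w' j = lead w j by rewrite /flip_pos E.
have [rh hM] := unlucky_hops j wU.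
(* Phases use disjoint blocks of the tapes, so in block [j] only this one bit of the leader can
   change. *)
have bitE u t : t < M -> (u, t) <> (lead w j, hops (lead w j)) ->
    bit w' (u, j * M + t) = bit w (u, j * M + t).
  move=> tM ne; rewrite bit_setbits /=; last exact: block_ltn.
  case: pickP => // i /eqP[ui] /block_inj[] //; first exact: (unlucky_hops i wU).2.
  by move/val_inj => ij ht; case: ne; rewrite -ui -ht ij.
have [cl maxl] := leadP w j.
apply: leadE => [|u'].
  rewrite /competes (ball_tape _ (fun v => tval (w v))); apply: ball_leq cl.
  rewrite leq_mul2l; apply/orP; right; rewrite rh; apply: reachw_ge => [|t th].
    exact: ltnW.
  rewrite bitE ?(ltn_trans th) //; first by apply: reachw_true; rewrite rh.
  by case=> E; rewrite E ltnn in th.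
have [->//|ne] := eqVneq u' (lead w j).
rewrite /competes (ball_tape _ (fun v => tval (w v))) (@reachw_eq w' w); first exact: maxl.
by move=> t tM; apply: bitE => // -[E _]; rewrite E eqxx in ne.
Qed.

(** Every phase offers one zero bit that can be reset freely, and the [q] positions are distinct. *)
Lemma card_unlucky : #|unlucky| * 2 ^ q <= #|{: W}|.
Proof.
apply: (@card_fixed_bits _ _ _ _ false flip_pos).
- move=> w wU i j [_] /block_inj[]; rewrite ?(unlucky_hops _ wU).2 //.
  by move/val_inj.
- move=> w j wU; have [rh hM] := unlucky_hops j wU.
  split; first exact: block_ltn.
  by apply/negbTE; rewrite /flip_pos -rh; apply: reachw_false; rewrite rh.
by move=> w b j; apply: flip_pos_setbits.
Qed.

End Vertex.

Definition overflow (p : G * 'I_q) : {set W} := [set w | M <= reachw w p.2 p.1].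

Lemma card_overflow p : #|overflow p| * 2 ^ M <= #|{: W}|.
Proof.
case: p => u j.
apply: (@card_fixed_bits _ _ _ _ true (fun _ (t : 'I_M) => (u, j * M + t))) => //.
- by move=> w _ t t' [/addnI/val_inj].
move=> w t; rewrite inE /= => le; split; first exact: block_ltn.
by apply: reachw_true; apply: leq_trans le.
Qed.

Definition failure : {set W} := [set w | `[< ~ forall v, clustered w v >]].

Lemma failure_sub :
  failure \subset (\bigcup_v unlucky v) :|: (\bigcup_p overflow p).
Proof.
apply/subsetP => w; rewrite inE => /asboolP/existsNP[v ncl].
apply/setUP; have [ok|] := boolP [forall j : 'I_q, reachw w j (lead v w j) < M].
  by left; apply/bigcupP; exists v; rewrite // inE ok andbT; apply/asboolP.
rewrite negb_forall => /existsP[j]; rewrite -leqNgt => le.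
by right; apply/bigcupP; exists (lead v w j, j); rewrite // inE.
Qed.

(** Union bound over the vertices, and over the [#|G| * q] radii that may overflow; the condition on
    [M] absorbs the factor [q]. *)
Lemma card_failure : 0 < q -> q * 2 ^ q <= 2 ^ M ->
  #|failure| * 2 ^ q <= 2 * #|G| * #|{: W}|.
Proof.
move=> q0 qM.
have U : \sum_v #|unlucky v| * 2 ^ q <= #|G| * #|{: W}|.
  apply: (@leq_trans (\sum_(v : G) #|{: W}|)); last by rewrite sum_nat_const.
  by apply: leq_sum => v _; apply: card_unlucky.
have O : \sum_p #|overflow p| * 2 ^ q <= #|G| * #|{: W}|.
  rewrite -(leq_pmul2l q0) big_distrr /=.
  apply: (@leq_trans (\sum_(p : G * 'I_q) #|{: W}|)).
    apply: leq_sum => p _; rewrite mulnCA.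
    by apply: leq_trans (card_overflow p); rewrite leq_mul2l qM orbT.
  by rewrite sum_nat_const card_prod card_ord mulnCA mulnA.
have C : #|failure| <= \sum_v #|unlucky v| + \sum_p #|overflow p|.
  apply: leq_trans (subset_leq_card failure_sub) _.
  apply: leq_trans (leq_card_setU _ _) _.
  by apply: leq_add; apply: card_bigcup_leq.
rewrite -!big_distrl /= in U O.
apply: leq_trans (leq_mul C (leqnn _)) _.
by rewrite mulnDl mul2n -addnn mulnDl leq_add.
Qed.

End Clustering.

(** * Choice of the parameters and analysis of a run *)

Section Constants.
Variables (R : realType) (k c' : nat) (eps : R).

(** In [2 ^ phases N], the final successor pays for the factor 2 of the union bound and the one in
    [c'.+1] for its factor [n], leaving [n ^ c']. *)
Definition phases (N : nat) : nat := (c'.+1 * up_log 2 N).+1.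
Definition block (N : nat) : nat := 2 * phases N.
Definition doubling : nat := (Num.truncn (eps^-1)%R).+1.
Definition steps (N : nat) : nat := doubling * (2 * up_log 2 N).+1.
Definition sep (N : nat) : nat := 2 * (steps N * (2 * k)) + 2 * k.
Definition horizon (N : nat) : nat :=
  (steps N).+1 * (2 * k) + sep N * block N + k.
Definition rounds (N : nat) : nat := phases N * (3 * horizon N).

Definition spanner_alg : local_alg :=
  gather (fun N => phases N * block N) rounds
    (fun N e x y => `[< selected k (sep N) (block N) (horizon N) (steps N)
                          (2 * k) eps e (phases N) x y >]).

(** With [z] the sum on the right, [steps] and [sep] are quadratic in [z]; [block] and [phases]
    contribute one factor [z] each. *)
Lemma rounds_leq N :
  rounds N <= 81 * k * c'.+1 ^ 2 * (up_log 2 N + doubling + 1) ^ 4.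
Proof.
rewrite /rounds /horizon /sep /block /steps /phases.
set l := up_log 2 N; set m := doubling; set d := c'.+1.
pose z := l + m + 1; rewrite -[l + m + 1]/z.
have d0 : 0 < d by []. have z0 : 0 < z by rewrite /z addn1.
have hq : (d * l).+1 <= d * z by rewrite /z; nia.
have hs : m * (2 * l).+1 <= 2 * z ^ 2 by rewrite /z; nia.
set q := (d * l).+1 in hq *; set s := m * _ in hs *.
have z1 : 1 <= z ^ 2 by rewrite expn_gt0 z0.
have hD : 2 * (s * (2 * k)) + 2 * k <= 10 * k * z ^ 2 by nia.
set D := 2 * (s * (2 * k)) + 2 * k in hD *.
have hDM : D * (2 * q) <= 20 * k * d * z ^ 3.
  apply: leq_trans (leq_mul hD (leq_mul (leqnn 2) hq)) _.
  by apply: eq_leq; ring.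
have z3 : z ^ 2 <= z ^ 3 by rewrite [leqRHS]expnS leq_pmull.
have hk : k * z ^ 2 <= k * d * z ^ 3.
  by apply: leq_mul z3; rewrite leq_pmulr.
have hB : s.+1 * (2 * k) + D * (2 * q) + k <= 27 * k * d * z ^ 3.
  have : s.+1 * (2 * k) + k <= 7 * (k * z ^ 2) by nia.
  by move: hDM hk; lia.
apply: leq_trans (leq_mul hq (leq_mul (leqnn 3) hB)) _.
by apply: eq_leq; ring.
Qed.

Hypothesis eps_gt0 : (0 < eps)%R.

Lemma bernoulli (x : R) n : (0 <= x)%R -> (1 + n%:R * x <= (1 + x) ^+ n)%R.
Proof.
move=> x0; elim: n => [|n IH]; first by rewrite mul0r addr0 expr0.
rewrite exprS; apply: le_trans (ler_wpM2l (addr_ge0 ler01 x0) IH).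
rewrite -natr1; have : (0 <= n%:R * x * x)%R by rewrite !mulr_ge0.
nra.
Qed.

(** As [doubling] exceeds [1 / eps], Bernoulli's inequality makes that many factors [1 + eps] at
    least 2; the one extra doubling in [steps] gives strictness. *)
Lemma steps_growth n N : 0 < N -> n <= N ->
  ((n ^ 2)%:R < (1 + eps) ^+ steps N)%R.
Proof.
move=> N0 nN; have two : (2 <= (1 + eps) ^+ doubling)%R.
  apply: le_trans (bernoulli _ (ltW eps_gt0)).
  have : (eps^-1 < doubling%:R :> R)%R by apply: truncnS_gt.
  by rewrite -(ltr_pM2r eps_gt0) mulVf ?gt_eqF //; lra.
apply: (@lt_le_trans _ _ (2 ^+ (2 * up_log 2 N).+1)%R); last first.
  by rewrite /steps exprM lerXn2r // ?nnegrE // (le_trans _ two).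
rewrite -natrX ltr_nat; apply: (@leq_ltn_trans (2 ^ (2 * up_log 2 N))).
  by rewrite mulnC expnM leq_sqr (leq_trans nN) // up_logP.
by rewrite ltn_exp2l.
Qed.

Lemma phases_ge n N : 0 < n -> n <= N -> 2 * n * n ^ c' <= 2 ^ phases N.
Proof.
move=> n0 nN; rewrite /phases expnS -mulnA -expnS leq_mul2l /= mulnC expnM.
by rewrite leq_exp2r // (leq_trans nN) // up_logP.
Qed.

Lemma block_ge N : phases N * 2 ^ phases N <= 2 ^ block N.
Proof.
by rewrite /block mul2n -addnn expnD leq_mul2r ltnW ?orbT // ltn_expl.
Qed.

Section Run.
Variables (G : sgraph) (id : G -> nat) (N : nat).
Hypotheses (id_inj : injective id) (k_gt0 : 0 < k).
Hypotheses (G_conn : connected_graph G) (leN : #|G| <= N).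
Notation W := (rand_tapes spanner_alg G N).

Lemma isolated_halted (w : W) : #|G| = 1 -> all_halted id w 0.
Proof.
move=> G1; apply: gather_isolated => v; apply/eqP; rewrite -size_eq0 size_sort.
rewrite -cardE; apply/eqP/eq_card0 => u; rewrite !inE.
have le1 : #|G| <= 1 by rewrite G1.
by rewrite (card_le1_eqP le1 u v) // adj_irr.
Qed.

Hypothesis G2 : 1 < #|G|.

Lemma nbrs_neq0 v : nbrs id v != [::].
Proof.
have [u uv] : exists u, u != v.
  apply: contrapT => h; move: G2; rewrite ltnNge => /negP; apply.
  apply/card_le1_eqP => x y _ _; apply: contrapT => xy.
  by apply: h; have [xv|] := eqVneq x v; [exists y; apply/eqP => yv; apply: xy; rewrite xv yv|exists x].
have /connectP[[|z p] /=] := G_conn.2 v u; first by move=> _ E; rewrite E eqxx in uv.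
move=> /andP[vz _] _; apply/eqP => E.
by have := mem_nbrs id v z; rewrite E vz.
Qed.

Lemma spanner_alg_halted (w : W) : all_halted id w (rounds N).
Proof. by apply: gather_halted => //; apply: nbrs_neq0. Qed.

Lemma spanner_alg_approx (w : W) :
  (forall v, clustered (sep N) id w v) ->
  approx_min_kspanner eps k (output_edges id w (rounds N)).
Proof.
move=> cl; rewrite (gather_output_edges id_inj nbrs_neq0); last first.
  have leB : (steps N).+1 * (2 * k) + sep N * block N <= horizon N by rewrite leq_addr.
  (* [rounds N] is exactly the radius on which [selected] depends. *)
  move=> e' x y ag; apply/asbool_equiv_eq; split; first exact: selected_local.
  by apply: selected_local => //; apply: agreeC.
apply: approx_chosen => //.
by apply: steps_growth => //; apply: leq_trans leN; apply: ltnW.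
Qed.

Lemma spanner_alg_prob (c : R) : (c <= c'%:R)%R ->
  (1 - 1 / (#|G|%:R `^ c) <=
   Pr R (fun w : W => approx_min_kspanner eps k (output_edges id w (rounds N))))%R.
Proof.
move=> cc'; rewrite /Pr; set S := [pred w | _].
pose F : {set W} := failure (sep N) (block N) (phases N) id.
have FS : #|{: W}| <= #|F| + #|S|.
  rewrite -(cardsC F) leq_add2l; apply/subset_leq_card/subsetP => w.
  rewrite !inE => /asboolP/contrapT cl; apply/asboolP.
  exact: spanner_alg_approx.
have W0 : 0 < #|{: W}| by rewrite card_ffun expn_gt0 card_tuple expn_gt0 card_bool.
have Fn : #|F| * #|G| ^ c' <= #|{: W}|.
  have := card_failure (sep N) id_inj (ltn0Sn _) (block_ge N).
  have := phases_ge (ltnW G2) leN.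
  rewrite -/F; set a := #|F|; set n := #|G|; set b := #|{: W}|; set x := n ^ c'.
  move=> h1 h2; have n0 : 0 < 2 * n by rewrite muln_gt0 /=; apply: ltnW.
  rewrite -(leq_pmul2l n0); apply: leq_trans h2.
  by rewrite mulnCA leq_mul2l h1 orbT.
have WR : (0 < #|{: W}|%:R :> R)%R by rewrite ltr0n.
rewrite ler_pdivlMr // mulrBl div1r mul1r lerBlDr.
apply: (@le_trans _ _ (#|F|%:R + #|S|%:R)%R); first by rewrite -natrD ler_nat.
rewrite addrC lerD2l mulrC ler_pdivlMr; last first.
  by rewrite powR_gt0 // ltr0n; apply: ltnW.
apply: (@le_trans _ _ (#|F| * #|G| ^ c')%:R%R); last by rewrite ler_nat.
rewrite natrM natrX; apply: ler_wpM2l => //.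
rewrite -powR_mulrn //; apply: ler_powR => //.
by rewrite (ler_nat _ 1); apply: ltnW.
Qed.

End Run.

End Constants.

(** * The round bound as a polynomial, and the conclusion *)

(** With [x = ln n / eps], both ingredients are linear in [x]: [ln n] is at most [eps0 * x], and
    [1 / eps] is at most [x / ln 2] because [n] is at least 2. *)
Lemma rounds_poly (R : realType) (k c' C n N : nat) (eps eps0 : R) :
  (0 < eps)%R -> (eps <= eps0)%R -> 1 < n -> n <= N <= C * n ^ C ->
  ((rounds k c' eps N)%:R <=
   (81 * k * c'.+1 ^ 2)%:R *
   (3 + ln C%:R / ln 2 + (C%:R * eps0 + 1) / ln 2 * (ln n%:R / eps)) ^+ 4)%R.
Proof.
move=> e0 ee0 n1 /andP[nN NC].
apply: le_trans (_ : _ <= (81 * k * c'.+1 ^ 2 * (up_log 2 N + doubling eps + 1) ^ 4)%:R)%R _.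
  by rewrite ler_nat rounds_leq.
rewrite natrM; apply: ler_wpM2l => //; rewrite natrX.
have l2 : (0 < ln 2 :> R)%R by rewrite ln_gt0 // ltr1n.
have ln2n : (ln 2 <= ln n%:R :> R)%R by rewrite ler_ln ?posrE ?ltr0n ?ler_nat //; apply: ltnW.
have C0 : 0 < C by case: C NC => //; rewrite mul0n leqn0; move: nN; lia.
have N1 : 1 < N by apply: leq_trans nN.
have lnN : (ln N%:R <= ln C%:R + C%:R * ln n%:R :> R)%R.
  apply: (@le_trans _ _ (ln (C * n ^ C)%:R)%R).
    by rewrite ler_ln ?posrE ?ltr0n ?ler_nat // ?muln_gt0 ?expn_gt0 ?C0 ?(ltnW n1) ?(ltnW N1).
  rewrite natrM natrX lnM ?posrE ?exprn_gt0 ?ltr0n // ?(ltnW n1) //.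
  by rewrite lnXn ?ltr0n ?(ltnW n1) // mulr_natl.
have lnl : (((up_log 2 N).-1)%:R * ln 2 <= ln N%:R :> R)%R.
  have := up_log_gtn (isT : 1 < 2) N1.
  rewrite -(ltr_nat R) natrX => /ltW h.
  rewrite mulr_natl -lnXn ?ltr0n // ler_ln ?posrE ?exprn_gt0 ?ltr0n //.
  exact: ltnW.
have lb : ((up_log 2 N)%:R <= 1 + (ln C%:R + C%:R * ln n%:R) / ln 2 :> R)%R.
  have -> : up_log 2 N = (up_log 2 N).-1.+1 by rewrite prednK // up_log_gt0.
  by rewrite -natr1 addrC lerD2l ler_pdivlMr //; apply: le_trans lnN.
set x := (ln n%:R / eps)%R.
have xe : (ln n%:R = eps * x)%R by rewrite /x mulrC divfK // gt_eqF.
have x0 : (0 <= x)%R by rewrite /x divr_ge0 // ltW // (lt_le_trans l2).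
have mb : ((doubling eps)%:R <= 1 + x / ln 2 :> R)%R.
  rewrite /doubling -natr1 addrC lerD2l.
  apply: le_trans (_ : _ <= eps^-1)%R _.
    have i0 : (0 <= eps^-1)%R by rewrite invr_ge0 ltW.
    by case/andP: (truncn_itv i0).
  rewrite ler_pdivlMr // /x mulrC; apply: ler_wpM2r => //.
  by rewrite invr_ge0 ltW.
apply: lerXn2r; rewrite ?nnegrE //; last first.
  rewrite !natrD; apply: le_trans (lerD (lerD lb mb) (lexx _)) _.
  have : (C%:R * ln n%:R / ln 2 <= C%:R * eps0 / ln 2 * x)%R.
    rewrite xe mulrA mulrAC; apply: ler_wpM2r => //.
    by apply: ler_wpM2r; [rewrite invr_ge0 ltW|apply: ler_wpM2l].
  have -> : ((C%:R * eps0 + 1) / ln 2 * x = C%:R * eps0 / ln 2 * x + x / ln 2)%R.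
    by ring.
  by rewrite [((ln _ + _) / _)%R]mulrDl; lra.
have lC : (0 <= ln C%:R :> R)%R by rewrite ln_ge0 // ler1n.
have e00 : (0 <= eps0)%R by apply: le_trans (ltW e0) ee0.
apply: addr_ge0; first by rewrite addr_ge0 // divr_ge0 // ltW.
by rewrite mulr_ge0 // divr_ge0 ?(ltW l2) // addr_ge0 // mulr_ge0.
Qed.

Local Open Scope ring_scope.

Theorem theorem2 (R : realType) (k C : nat) (c eps0 : R) :
  (0 < k)%N -> 1 <= c -> 0 < eps0 ->
  exists p : {poly R},
  forall eps : R, 0 < eps -> eps <= eps0 ->
  exists A : local_alg,
  forall (G : sgraph) (id : G -> nat) (N : nat),
    connected_graph G -> injective id ->
    (#|G| <= N <= C * #|G| ^ C)%N ->
  exists T : nat,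
    [/\ T%:R <= p.[ln #|G|%:R / eps],
        forall w : rand_tapes A G N, all_halted id w T
      & 1 - 1 / (#|G|%:R `^ c) <=
        Pr R (fun w : rand_tapes A G N =>
                approx_min_kspanner eps k (output_edges id w T))].
Proof.
move=> k0 c1 eps00; pose c' := (Num.truncn c).+1%N.
exists ((81 * k * c'.+1 ^ 2)%N%:R *:
  ((3 + ln C%:R / ln 2)%:P + ((C%:R * eps0 + 1) / ln 2) *: 'X) ^+ 4).
move=> eps e0 ee0; exists (spanner_alg k c' eps) => G id N Gc id_inj NC.
rewrite hornerZ horner_exp hornerD hornerC hornerZ hornerX.
(* On one vertex [ln 1 = 0], so the polynomial is evaluated at 0; the run takes no round and the
   required probability is 0. *)
have [G1|G2] := leqP #|G| 1.
  have {}G1 : #|G| = 1%N by apply/eqP; rewrite eqn_leq G1; case: Gc.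
  exists 0%N; split.
  - by rewrite mulr_ge0 // exprn_even_ge0.
  - by move=> w; apply: isolated_halted.
  - by rewrite G1 powR1 divr1 subrr /Pr divr_ge0.
exists (rounds k c' eps N); split; first exact: rounds_poly.
  by move=> w; apply: spanner_alg_halted.
apply: spanner_alg_prob => //; first by case/andP: NC.
exact/ltW/truncnS_gt.
Qed.
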